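(* Let $R$ be a maximal subring of a ring $T$. Then $\mathrm{Char}(\mathrm{End}_{\mathbb{Z}}(T/R))$ is either $0$ or a prime number. Moreover, $\mathrm{Char}(R/(R:T)_l)=\mathrm{Char}(R/(R:T)_r)=\mathrm{Char}(R/(R:T))$.
   Context: All rings are associative, unital with $1\neq 0$, and not necessarily commutative; subrings contain the identity of the overring. A subring $R\subsetneq T$ is a maximal subring of $T$ if there is no subring $S$ with $R\subsetneq S\subsetneq T$. $(R:T):=\{x\in T\mid TxT\subseteq R\}$, $(R:T)_l:=\{x\in T\mid Tx\subseteq R\}$ and $(R:T)_r:=\{x\in T\mid xT\subseteq R\}$ are respectively the largest two-sided, left and right ideal of $T$ contained in $R$; all are two-sided ideals of $R$. $\mathrm{Char}(S)$ is the characteristic of a ring $S$, and $\mathrm{End}_{\mathbb{Z}}(T/R)$ is the endomorphism ring of the abelian group $T/R$. *)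

(* Defs.v *)
From HB Require Import structures.
From mathcomp Require Import all_boot all_order all_algebra.
From mathcomp Require Import boolp.

Set Implicit Arguments.
Unset Strict Implicit.
Unset Printing Implicit Defensive.

Import GRing.Theory.
Local Open Scope ring_scope.
Local Open Scope quotient_scope.

(* The library's [pchar A] only records prime characteristics. *)
Definition ringChar (A : pzRingType) : nat :=
  if pselect (exists n, (0 < n)%N && (n%:R == 0 :> A)) is left h
  then ex_minn h else 0%N.

Lemma ringCharP (A : pzRingType) (n : nat) :
  n%:R = 0 :> A <-> (ringChar A %| n)%N.
Proof.
rewrite /ringChar; case: pselect => [h | nh].
  case: ex_minnP => m /andP[m0 /eqP mA0] mmin; split=> [nA0|/dvdnP[k ->]]; last first.
    by rewrite natrM mA0 mulr0.
  rewrite /dvdn; case: (posnP (n %% m)) => [//|r0].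
  have rA0 : (n %% m)%:R = 0 :> A.
    by move: nA0; rewrite {1}(divn_eq n m) natrD natrM mA0 mulr0 add0r.
  have := mmin (n %% m)%N; rewrite r0 rA0 eqxx => /(_ isT).
  by rewrite leqNgt ltn_mod m0.
split=> [nA0|]; last by rewrite dvd0n => /eqP->.
rewrite dvd0n; case: (posnP n) => [//|n0]; case: nh; exists n.
by rewrite n0 nA0 eqxx.
Qed.

(* [Endo M] is End_Z(M), with composition as multiplication. *)
Definition Endo (M : zmodType) : Type := {additive M -> M}.

Section EndoRing.
Variable M : zmodType.
Implicit Types f g h : Endo M.

Definition endo_fun f : M -> M := f : {additive M -> M}.

Lemma endoP f g : endo_fun f =1 endo_fun g -> f = g.
Proof.
case: f => f [[cf]]; case: g => g [[cg]] /= /funext fg.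
rewrite /endo_fun /= in fg; subst g.
congr (Algebra.Additive.Pack (Algebra.Additive.Class _));
by congr (Algebra.isNmodMorphism.Axioms_ _); exact: Prop_irrelevance.
Qed.

HB.instance Definition _ := gen_eqMixin (Endo M).
HB.instance Definition _ := gen_choiceMixin (Endo M).

Definition endo0 : Endo M := \0 : {additive M -> M}.
Definition endoN f : Endo M := \- endo_fun f : {additive M -> M}.
Definition endoD f g : Endo M := endo_fun f \+ endo_fun g : {additive M -> M}.
Definition endo1 : Endo M := idfun : {additive M -> M}.
Definition endoM f g : Endo M := endo_fun f \o endo_fun g : {additive M -> M}.

Lemma endoDA : associative endoD.
Proof. by move=> f g h; apply: endoP => x; apply: addrA. Qed.
Lemma endoDC : commutative endoD.
Proof. by move=> f g; apply: endoP => x; apply: addrC. Qed.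
Lemma endo0D : left_id endo0 endoD.
Proof. by move=> f; apply: endoP => x; apply: add0r. Qed.
Lemma endoND : left_inverse endo0 endoN endoD.
Proof. by move=> f; apply: endoP => x; apply: addNr. Qed.

HB.instance Definition _ :=
  GRing.isZmodule.Build (Endo M) endoDA endoDC endo0D endoND.

Lemma endoMA : associative endoM.
Proof. by move=> f g h; apply: endoP. Qed.
Lemma endo1M : left_id endo1 endoM.
Proof. by move=> f; apply: endoP. Qed.
Lemma endoM1 : right_id endo1 endoM.
Proof. by move=> f; apply: endoP. Qed.
Lemma endoMDl : left_distributive endoM +%R.
Proof. by move=> f g h; apply: endoP. Qed.
Lemma endoMDr : right_distributive endoM +%R.
Proof. by move=> f g h; apply: endoP => x; apply: raddfD. Qed.

HB.instance Definition _ :=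
  GRing.Zmodule_isPzRing.Build (Endo M) endoMA endo1M endoM1 endoMDl endoMDr.
End EndoRing.

(* The library's [idealr] is one-sided, and [{ideal_quot I}] is a ring only
   when the base ring is commutative. *)
Definition absorbing (A : nzRingType) (I : {pred A}) : Prop :=
  forall a, {in I, forall u, (a * u \in I) /\ (u * a \in I)}.

HB.mixin Record isAbsorbing (A : nzRingType) (I : A -> bool) := {
  absorbing_subproof : absorbing I
}.

#[short(type="ideal2")]
HB.structure Definition Ideal2 (A : nzRingType) :=
  {I of GRing.ZmodClosed A I & isAbsorbing A I}.

Definition quotRing (A : nzRingType) (I : ideal2 A) : Type := Quotient.quot I.

Section QuotRing.
Variables (A : nzRingType) (I : ideal2 A).
Notation Q := (Quotient.quot I).

HB.instance Definition _ := GRing.Zmodule.on (quotRing I).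

Definition qone : quotRing I := \pi_Q 1.
Definition qmul (x y : quotRing I) : quotRing I :=
  \pi_Q (repr (x : Q) * repr (y : Q)).

Lemma pi_qmul (x y : A) : qmul (\pi_Q x) (\pi_Q y) = \pi_Q (x * y).
Proof.
apply/eqP; rewrite /qmul -Quotient.idealrBE.
set x' := repr _; set y' := repr _.
have xx' : x' - x \in I by rewrite Quotient.idealrBE reprK.
have yy' : y' - y \in I by rewrite Quotient.idealrBE reprK.
rewrite -[x' * y'](subrK (x' * y)) -mulrBr -addrA -mulrBl.
by apply: rpredD; [apply: (absorbing_subproof x' _ yy').1
                  | apply: (absorbing_subproof y _ xx').2].
Qed.

Lemma qmulA : associative qmul.
Proof.
move=> x y z; rewrite -[x](@reprK _ Q) -[y](@reprK _ Q) -[z](@reprK _ Q).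
by rewrite !pi_qmul mulrA.
Qed.
Lemma q1mul : left_id qone qmul.
Proof. by move=> x; rewrite -[x](@reprK _ Q) pi_qmul mul1r. Qed.
Lemma qmul1 : right_id qone qmul.
Proof. by move=> x; rewrite -[x](@reprK _ Q) pi_qmul mulr1. Qed.
Lemma qmulDl : left_distributive qmul +%R.
Proof.
move=> x y z; rewrite -[x](@reprK _ Q) -[y](@reprK _ Q) -[z](@reprK _ Q).
by rewrite !pi_qmul -!(raddfD (\pi_Q)) pi_qmul mulrDl.
Qed.
Lemma qmulDr : right_distributive qmul +%R.
Proof.
move=> x y z; rewrite -[x](@reprK _ Q) -[y](@reprK _ Q) -[z](@reprK _ Q).
by rewrite !pi_qmul -!(raddfD (\pi_Q)) pi_qmul mulrDr.
Qed.

HB.instance Definition _ :=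
  GRing.Zmodule_isPzRing.Build (quotRing I) qmulA q1mul qmul1 qmulDl qmulDr.
End QuotRing.

Definition psubset (T : Type) (A B : {pred T}) : Prop :=
  {subset A <= B} /\ ~ {subset B <= A}.

(* Boolean predicates lose no generality here: by [boolp], every subset of [T]
   is one. *)
Definition maximal_subring (T : nzRingType) (R : subringClosed T) : Prop :=
  psubset R predT /\
  ~ (exists S : subringClosed T, psubset R S /\ psubset S predT).

Record subring (T : nzRingType) (R : subringClosed T) :=
  Subring { subring_val : T; _ : subring_val \in R }.

Section Subring.
Variables (T : nzRingType) (R : subringClosed T).

HB.instance Definition _ := [isSub for @subring_val T R].
HB.instance Definition _ := [Choice of subring R by <:].
HB.instance Definition _ := [SubChoice_isSubNzRing of subring R by <:].

(* Testing products suffices even if [T x T] denotes their additive span, as [R]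
   is closed under sums. *)
Definition conductor : {pred T} := fun x => `[< forall a b : T, a * x * b \in R >].
Definition conductorl : {pred T} := fun x => `[< forall a : T, a * x \in R >].
Definition conductorr : {pred T} := fun x => `[< forall b : T, x * b \in R >].

Definition cond_ideal : {pred subring R} := fun u => \val u \in conductor.
Definition condl_ideal : {pred subring R} := fun u => \val u \in conductorl.
Definition condr_ideal : {pred subring R} := fun u => \val u \in conductorr.

Lemma cond_zmod : zmod_closed cond_ideal.
Proof.
split=> [|u v /asboolP uI /asboolP vI]; apply/asboolP => a b.
  by rewrite raddf0 mulr0 mul0r rpred0.
by rewrite raddfB mulrBr mulrBl rpredB.
Qed.
Lemma cond_absorbing : absorbing cond_ideal.
Proof.
move=> c u /asboolP uI; split; apply/asboolP => a b; rewrite rmorphM.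
  by rewrite mulrA.
by rewrite mulrA -(mulrA _ _ b).
Qed.
HB.instance Definition _ := GRing.isZmodClosed.Build _ cond_ideal cond_zmod.
HB.instance Definition _ := isAbsorbing.Build _ cond_ideal cond_absorbing.

Lemma condl_zmod : zmod_closed condl_ideal.
Proof.
split=> [|u v /asboolP uI /asboolP vI]; apply/asboolP => a.
  by rewrite raddf0 mulr0 rpred0.
by rewrite raddfB mulrBr rpredB.
Qed.
Lemma condl_absorbing : absorbing condl_ideal.
Proof.
move=> c u /asboolP uI; split; apply/asboolP => a; rewrite rmorphM mulrA //.
by rewrite rpredM //; apply: valP.
Qed.
HB.instance Definition _ := GRing.isZmodClosed.Build _ condl_ideal condl_zmod.
HB.instance Definition _ := isAbsorbing.Build _ condl_ideal condl_absorbing.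

Lemma condr_zmod : zmod_closed condr_ideal.
Proof.
split=> [|u v /asboolP uI /asboolP vI]; apply/asboolP => a.
  by rewrite raddf0 mul0r rpred0.
by rewrite raddfB mulrBl rpredB.
Qed.
Lemma condr_absorbing : absorbing condr_ideal.
Proof.
move=> c u /asboolP uI; split; apply/asboolP => a; rewrite rmorphM -mulrA //.
by rewrite rpredM //; apply: valP.
Qed.
HB.instance Definition _ := GRing.isZmodClosed.Build _ condr_ideal condr_zmod.
HB.instance Definition _ := isAbsorbing.Build _ condr_ideal condr_absorbing.
End Subring.

Arguments conductor {T} R _.
Arguments conductorl {T} R _.
Arguments conductorr {T} R _.
Arguments cond_ideal {T} R _.
Arguments condl_ideal {T} R _.
Arguments condr_ideal {T} R _.

(* Main.v *)
Require Import Defs.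
From mathcomp Require Import all_boot all_order all_algebra.
From HB Require Import structures.
From mathcomp Require Import boolp.
Local Open Scope ring_scope.

(** Integers are central in [T], so for a natural number [n] the conditions
    [Tn <= R], [nT <= R] and [TnT <= R] coincide, and they also say that [n]
    annihilates the group [T/R].  Hence the four characteristics in question are
    all the generator of the ideal of integers [n] such that [nT <= R].

    It remains to see that this generator [m] is prime when nonzero.  First,
    [m <> 1] as [R] is proper.  Now let [m = a * b].  The set [R + aT] is a
    subring between [R] and [T], so by maximality it is [R] or [T].  In the
    former case [aT <= R], so that [m] divides [a]; in the latter,
    [bT = bR + abT <= R], so that [m] divides [b]. *)

Import GRing.Theory.
Local Open Scope quotient_scope.

Lemma eq_ringChar (A B : pzRingType) :
  (forall n, n%:R = 0 :> A <-> n%:R = 0 :> B) -> ringChar A = ringChar B.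
Proof.
move=> AB; apply/eqP; rewrite eqn_dvd; apply/andP.
by split; apply/ringCharP/AB/ringCharP.
Qed.

Lemma quotRing_nat_eq0 (A : nzRingType) (I : ideal2 A) n :
  n%:R = 0 :> quotRing I <-> n%:R \in I.
Proof.
have -> : n%:R = \pi_(Quotient.quot I) n%:R :> quotRing I.
  by rewrite (raddfMn (\pi_(Quotient.quot I))).
rewrite -[X in X \in I]subr0 Quotient.idealrBE.
rewrite -[X in _ = X <-> _](raddf0 (\pi_(Quotient.quot I))).
by split=> [->|/eqP].
Qed.

Section Multiples.
Variables (T : nzRingType) (R : subringClosed T).

(** The inclusion [nT <= R]. *)
Definition multiples_in (n : nat) : Prop := forall t : T, t *+ n \in R.

Lemma Endo_nat_eq0 n :
  n%:R = 0 :> Endo (Quotient.quot R) <-> multiples_in n.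
Proof.
have natE x : endo_fun (n%:R : Endo (Quotient.quot R)) x = x *+ n.
  elim: n => [//|n IHn]; rewrite mulrSr [x *+ _]mulrSr -IHn //.
have piE (t : T) : (t *+ n \in R) = (\pi_(Quotient.quot R) t *+ n == 0).
  by rewrite -[X in X \in R]subr0 Quotient.idealrBE raddfMn raddf0.
split=> [n0 t|nR]; first by rewrite piE -natE n0.
by apply: endoP => x; rewrite natE -[x]reprK; apply/eqP; rewrite -piE.
Qed.

Lemma condl_nat n : n%:R \in condl_ideal R <-> multiples_in n.
Proof.
rewrite /condl_ideal unfold_in; split=> [/asboolP nR t|nR].
  by have := nR t; rewrite rmorph_nat mulr_natr.
by apply/asboolP => a; rewrite rmorph_nat mulr_natr.
Qed.

Lemma condr_nat n : n%:R \in condr_ideal R <-> multiples_in n.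
Proof.
rewrite /condr_ideal unfold_in; split=> [/asboolP nR t|nR].
  by have := nR t; rewrite rmorph_nat mulr_natl.
by apply/asboolP => a; rewrite rmorph_nat mulr_natl.
Qed.

Lemma cond_nat n : n%:R \in cond_ideal R <-> multiples_in n.
Proof.
rewrite /cond_ideal unfold_in; split=> [/asboolP nR t|nR].
  by have := nR t 1; rewrite rmorph_nat mulr_natr mulr1.
by apply/asboolP => a b; rewrite rmorph_nat mulr_natr mulrnAl.
Qed.

(** The set [R + aT]. *)
Definition add_multiples (a : nat) : {pred T} :=
  fun x => `[< exists2 r, r \in R & exists t, x = r + t *+ a >].

Lemma add_multiplesP a x :
  reflect (exists2 r, r \in R & exists t, x = r + t *+ a)
          (x \in add_multiples a).
Proof. exact: asboolP. Qed.

Lemma add_multiples_subring a : subring_closed (add_multiples a).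
Proof.
split=> [|_ _ /add_multiplesP[r rR [t ->]] /add_multiplesP[s sR [u ->]]
         |_ _ /add_multiplesP[r rR [t ->]] /add_multiplesP[s sR [u ->]]].
- by apply/add_multiplesP; exists 1; rewrite ?rpred1 //; exists 0;
    rewrite mul0rn addr0.
- apply/add_multiplesP; exists (r - s); first exact: rpredB.
  by exists (t - u); rewrite mulrnBl opprD addrACA.
- apply/add_multiplesP; exists (r * s); first exact: rpredM.
  exists (r * u + t * s + t * (u *+ a)).
  by rewrite !mulrDl !mulrDr !mulrnDl !mulrnAl !mulrnAr !addrA.
Qed.

HB.instance Definition _ a :=
  GRing.isSubringClosed.Build T (add_multiples a) (add_multiples_subring a).

(** Maximality is applied here to the subring [R + aT]: if it is [R] then
    [aT <= R], and if it is [T] then [bT = bR + abT <= R]. *)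
Lemma multiples_in_mul a b : maximal_subring R ->
  multiples_in (a * b) -> multiples_in a \/ multiples_in b.
Proof.
move=> [_ maxR] abR; case: (pselect (multiples_in a)) => [|naR]; first by left.
right.
have subRa : {subset R <= add_multiples a}.
  move=> r rR; apply/add_multiplesP; exists r => //.
  by exists 0; rewrite mul0rn addr0.
have subTa : {subset predT <= add_multiples a}.
  apply: contrapT => nTa; apply: maxR.
  exists (GRing.SubringClosed.clone T (add_multiples a) _).
  split; split=> // aR; apply: naR => t; apply: aR.
  by apply/add_multiplesP; exists 0; rewrite ?rpred0 //; exists t; rewrite add0r.
move=> t; have /add_multiplesP[r rR [u ->]] := subTa t isT.
by rewrite mulrnDl -mulrnA rpredD // rpredMn.
Qed.

Lemma ringChar_Endo_prime : maximal_subring R ->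
  ringChar (Endo (Quotient.quot R)) = 0%N \/
  prime (ringChar (Endo (Quotient.quot R))).
Proof.
move=> hR; set m := ringChar _.
have mE n : (m %| n)%N <-> multiples_in n by rewrite -ringCharP Endo_nat_eq0.
have [->|m_gt0] := posnP m; [by left | right].
have m_neq1 : m != 1%N.
  apply/eqP => m1; have [[_ nTR] _] := hR; apply: nTR.
  by move=> t _; rewrite -[t]mulr1n; apply: (mE 1%N).1; rewrite m1.
apply/primeP; split=> [|a]; first by rewrite ltn_neqAle eq_sym m_neq1.
move=> /dvdnP[b mba]; move: (m_gt0); rewrite mba muln_gt0 => /andP[b_gt0 a_gt0].
have /(multiples_in_mul _ _ hR)[] : multiples_in (b * a) by rewrite -mba; apply/mE.
- move=> /mE; rewrite mba -[X in (_ %| X)%N]muln1 dvdn_pmul2l // dvdn1.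
  by move=> ->.
- move=> /mE; rewrite mba -[X in (_ %| X)%N]mul1n dvdn_pmul2r // dvdn1.
  by move=> /eqP->; rewrite mul1n eqxx orbT.
Qed.

End Multiples.

Theorem proposition2p17 (T : nzRingType) (R : subringClosed T)
  (hR : maximal_subring R) :
  (ringChar (Endo (Quotient.quot R)) = 0%N \/ prime (ringChar (Endo (Quotient.quot R)))) /\
  (ringChar (quotRing (condl_ideal R)) = ringChar (quotRing (condr_ideal R)) /\
   ringChar (quotRing (condr_ideal R)) = ringChar (quotRing (cond_ideal R))).
Proof.
split; first exact: ringChar_Endo_prime.
by split; apply: eq_ringChar => n;
  rewrite !quotRing_nat_eq0 ?condl_nat ?condr_nat ?cond_nat.
Qed.
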